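(* Let $\gamma$ be a singular graphon with edge density $p>0$, let $n\ge1$ and $z\in\mathbb{C}$. For any real parameters $\varepsilon_1,\ldots,\varepsilon_n$, the determinant $$DL_n(z,\gamma;\varepsilon_1,\ldots,\varepsilon_n)=\det\!\left((1+pz)I_n+z\,\mathrm{diag}(\varepsilon_1,\ldots,\varepsilon_n)-z\,\frac{L_n(\gamma)}{n}\right)$$ has expectation $$\mathbb{E}[DL_n(z,\gamma;\varepsilon_1,\ldots,\varepsilon_n)]=\left(\prod_{i=1}^n(1+\varepsilon_iz)\right)\left(\frac1n\sum_{i=1}^n\frac{1+pz+\varepsilon_iz}{1+\varepsilon_iz}\right).$$
   Context: Graphs are finite, simple and undirected, with at least one vertex. A graph function is a measurable symmetric $g:[0,1]^2\to[0,1]$ (up to null sets); a graphon $\gamma=[g]$ is an equivalence class of graph functions for the relation $\delta_\square=0$, where $\delta_\square$ is the cut-metric $\inf_\sigma \sup_{S,T}|\int_{S\times T}(g_1(\sigma(x),\sigma(y))-g_2(x,y))\,dx\,dy|$, $\sigma$ running over measure-preserving measurable bijections of $[0,1]$ and $S,T$ over measurable subsets. For a graph $F$ on $\{1,\dots,k\}$, $t(F,\gamma)=\int_{[0,1]^k}\prod_{\{i,j\}\in E_F}g(x_i,x_j)\,dx_1\cdots dx_k$. The edge density of $\gamma$ is $p=\int_{[0,1]^2}g$. For graphs $F_1,F_2$ on $k_1,k_2$ vertices, $F_1F_2$ is their disjoint union and $(F_1\bowtie F_2)(i_1,i_2)$ is the graph obtained from it by identifying vertex $i_1$ of $F_1$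 with vertex $i_2$ of $F_2$. The graphon $\gamma$ is singular if for all finite graphs $F_1,F_2$, $t(F_1F_2,\gamma)=\frac1{k_1k_2}\sum_{i_1=1}^{k_1}\sum_{i_2=1}^{k_2}t((F_1\bowtie F_2)(i_1,i_2),\gamma)$. The $W$-random graph $G_n(\gamma)$ has vertex set $\{1,\dots,n\}$; with $(X_i)$ and $(U_{ij})_{i<j}$ independent uniform on $[0,1]$, $i<j$ are connected iff $U_{ij}\le g(X_i,X_j)$. $L_n(\gamma)=D-A$ is its Laplacian matrix, with $A$ the adjacency matrix and $D$ the diagonal matrix of vertex degrees. The right-hand side of the formula is understood as the polynomial $\frac1n\sum_{i=1}^n(1+pz+\varepsilon_iz)\prod_{j\ne i}(1+\varepsilon_jz)$ when some factor $1+\varepsilon_iz$ vanishes. *)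

(* Defs.v *)
From HB Require Import structures.
From mathcomp Require Import all_boot all_order all_algebra.
From mathcomp Require Import all_classical all_reals all_analysis.
From mathcomp Require Import complex.

Set Implicit Arguments.
Unset Strict Implicit.
Unset Printing Implicit Defensive.

Import Order.TTheory GRing.Theory Num.Theory.
Import numFieldNormedType.Exports.

Local Open Scope classical_set_scope.
Local Open Scope complex_scope.
Local Open Scope ring_scope.

Record simple_graph (k : nat) := SimpleGraph {
  edge :> rel 'I_k;
  edge_sym : symmetric edge;
  edge_irr : irreflexive edge }.

Section GraphOperations.
Variables k1 k2 : nat.

Definition disj_union_rel (F1 : simple_graph k1) (F2 : simple_graph k2) :
    rel 'I_(k1 + k2) :=
  fun a b => match fintype.split a, fintype.split b with
             | inl u, inl v => F1 u v
             | inr u, inr v => F2 u v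
             | _, _ => false
             end.

Fact disj_union_sym F1 F2 : symmetric (disj_union_rel F1 F2).
Proof.
move=> a b; rewrite /disj_union_rel.
by case: (fintype.split a) => u; case: (fintype.split b) => v //; exact: edge_sym.
Qed.

Fact disj_union_irr F1 F2 : irreflexive (disj_union_rel F1 F2).
Proof.
by move=> a; rewrite /disj_union_rel; case: (fintype.split a) => u; exact: edge_irr.
Qed.

Definition disj_union F1 F2 : simple_graph (k1 + k2) :=
  SimpleGraph (disj_union_sym F1 F2) (disj_union_irr F1 F2).

(* The vertices of the graph obtained by identifying the vertex i1 of F1 with
   the vertex i2 of F2 are those of F1 followed by those of F2 other than i2;
   glue_l and glue_r i1 i2 are the images of the vertices of F1 and of F2. *)
Definition glue_l (u : 'I_k1) : 'I_(k1 + k2.-1) := lshift k2.-1 u.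

Definition glue_r (i1 : 'I_k1) (i2 v : 'I_k2) : 'I_(k1 + k2.-1) :=
  if unlift i2 v is Some w then rshift k1 w else lshift k2.-1 i1.

Definition glue_rel (F1 : simple_graph k1) (F2 : simple_graph k2)
    (i1 : 'I_k1) (i2 : 'I_k2) : rel 'I_(k1 + k2.-1) :=
  fun a b =>
    [exists u, exists v, [&& F1 u v, a == glue_l u & b == glue_l v]] ||
    [exists u, exists v, [&& F2 u v, a == glue_r i1 i2 u & b == glue_r i1 i2 v]].

Fact glue_sym F1 F2 i1 i2 : symmetric (glue_rel F1 F2 i1 i2).
Proof.
suff H a b : glue_rel F1 F2 i1 i2 a b -> glue_rel F1 F2 i1 i2 b a.
  by move=> a b; apply/idP/idP; exact: H.
case/orP=> /existsP[u /existsP[v /and3P[Fuv au bv]]]; apply/orP; [left|right];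
  apply/existsP; exists v; apply/existsP; exists u;
  by rewrite edge_sym Fuv bv au.
Qed.

Fact glue_r_inj i1 i2 : injective (glue_r i1 i2).
Proof.
move=> u v; rewrite /glue_r; case: unliftP => [u' ->|->]; case: unliftP => [v' ->|->] //.
- by move/rshift_inj=> ->.
- by move/eqP; rewrite eq_rlshift.
- by move/eqP; rewrite eq_lrshift.
Qed.

Fact glue_irr F1 F2 i1 i2 : irreflexive (glue_rel F1 F2 i1 i2).
Proof.
move=> a; apply/negP.
case/orP=> /existsP[u /existsP[v /and3P[Fuv /eqP au /eqP av]]].
  by move: Fuv; rewrite (lshift_inj (etrans (esym au) av)) edge_irr.
by move: Fuv; rewrite (@glue_r_inj i1 i2 u v) ?edge_irr// -au -av.
Qed.

Definition glue F1 F2 i1 i2 : simple_graph (k1 + k2.-1) :=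
  SimpleGraph (glue_sym F1 F2 i1 i2) (glue_irr F1 F2 i1 i2).

End GraphOperations.

(* Lebesgue measure on [0,1], as a probability on R, and its k-fold product,
   concentrated on [0,1]^k, as a probability on k-tuples.  unif01 is
   uniform_prob transported from measurableTypeR R to R. *)
Section CubeMeasure.
Variable R : realType.

Definition unif01 (A : set R) : \bar R := uniform_prob (@ltr01 R) A.

Let unif01_0 : unif01 set0 = 0%E.
Proof. exact: (measure0 (uniform_prob (@ltr01 R))). Qed.

Let unif01_ge0 A : (0 <= unif01 A)%E.
Proof. exact: (measure_ge0 (uniform_prob (@ltr01 R))). Qed.

Let unif01_sigma_additive : semi_sigma_additive unif01.
Proof. exact: (@measure_semi_sigma_additive _ _ _ (uniform_prob (@ltr01 R))). Qed.

HB.instance Definition _ := isMeasure.Build _ _ _ unif01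
  unif01_0 unif01_ge0 unif01_sigma_additive.

Let unif01_setT : unif01 setT = 1%E.
Proof. exact: (@probability_setT _ _ _ (uniform_prob (@ltr01 R))). Qed.

HB.instance Definition _ := Measure_isProbability.Build _ _ _ unif01 unif01_setT.

Definition tcons (k : nat) (xt : R * k.-tuple R) : k.+1.-tuple R :=
  [tuple of xt.1 :: xt.2].

Fact measurable_tcons k : measurable_fun setT (@tcons k).
Proof. exact: measurable_cons measurable_fst measurable_snd. Qed.

HB.instance Definition _ k :=
  isMeasurableFun.Build _ _ _ _ (@tcons k) (@measurable_tcons k).

Fixpoint cube_prob (k : nat) : probability (k.-tuple R) R :=
  match k with
  | 0 => \d_([tuple] : 0.-tuple R)
  | k'.+1 =>
      distribution ((unif01 \x cube_prob k')%E : probability _ R) (@tcons k')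
  end.

End CubeMeasure.

Definition unit_cube (R : realType) (k : nat) : set (k.-tuple R) :=
  [set t | forall i, tnth t i \in `[0, 1]].

Definition unit_square (R : realType) : set (R * R) := `[0, 1] `*` `[0, 1].

Arguments unit_cube : clear implicits.
Arguments unit_square : clear implicits.

(* The values of a graph function outside [0,1]^2 are irrelevant. *)
Record graph_function (R : realType) := GraphFunction {
  gf_fun :> R * R -> R;
  gf_measurable : measurable_fun (unit_square R) gf_fun;
  gf_sym : forall x y, unit_square R (x, y) -> gf_fun (x, y) = gf_fun (y, x);
  gf_range : forall x y, unit_square R (x, y) -> 0 <= gf_fun (x, y) <= 1 }.

(* The graphon [g] is handled through a representative g: homomorphism
   densities, edge density, singularity and the law of the W-random graph depend
   only on the class of g for the cut metric, and statements are made for every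
   graph function g, hence for every representative of every graphon. *)
Section Densities.
Variables (R : realType) (g : graph_function R).

Definition hom_density (k : nat) (F : simple_graph k) : R :=
  (\int[cube_prob R k]_(x in unit_cube R k)
    \prod_(e : 'I_k * 'I_k | (e.1 < e.2)%N && F e.1 e.2)
      g (tnth x e.1, tnth x e.2))%R.

Definition edge_density : R :=
  (\int[(@unif01 R \x @unif01 R)%E]_(x in unit_square R) g x)%R.

Definition singular : Prop :=
  forall (k1 k2 : nat) (F1 : simple_graph k1) (F2 : simple_graph k2),
    (0 < k1)%N -> (0 < k2)%N ->
    hom_density (disj_union F1 F2) =
    (k1%:R * k2%:R)^-1 *
      \sum_(i1 < k1) \sum_(i2 < k2) hom_density (glue F1 F2 i1 i2).

End Densities.

Section Probability.
Context d (T : measurableType d) (R : realType) (P : probability T R).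

Definition mutually_independent (I : finType) (Y : I -> {RV P >-> R}) : Prop :=
  forall (J : {set I}) (B : I -> set R), (forall i, measurable (B i)) ->
    P (\bigcap_(i in [set` J]) Y i @^-1` B i) =
    (\prod_(i in J) P (Y i @^-1` B i))%E.

(* A [0,1]-valued random variable with the uniform law. *)
Definition uniform01 (X : {RV P >-> R}) : Prop :=
  (forall w, X w \in `[0, 1]) /\
  (forall B : set R, measurable B -> distribution P X B = unif01 B).

Definition iid_uniform01 (I : finType) (Y : I -> {RV P >-> R}) : Prop :=
  (forall i, uniform01 (Y i)) /\ mutually_independent Y.

(* Z is integrable and has mean m. *)
Definition has_expectation (Z : T -> R[i]) (m : R[i]) : Prop :=
  [/\ P.-integrable setT (fun w => (complex.Re (Z w))%:E),
      P.-integrable setT (fun w => (complex.Im (Z w))%:E),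
      'E_P[fun w => complex.Re (Z w)]%E = (complex.Re m)%:E
    & 'E_P[fun w => complex.Im (Z w)]%E = (complex.Im m)%:E].

(* The variables (X_i)_i and (U_ij)_(i<j); U i j is not used for j <= i. *)
Definition sampling_family (n : nat) (X : 'I_n -> {RV P >-> R})
    (U : 'I_n -> 'I_n -> {RV P >-> R})
    (s : ('I_n + {e : 'I_n * 'I_n | (e.1 < e.2)%N})%type) : {RV P >-> R} :=
  match s with
  | inl i => X i
  | inr e => U (val e).1 (val e).2
  end.

Definition W_random_graph (g : graph_function R) (n : nat)
    (X : 'I_n -> {RV P >-> R}) (U : 'I_n -> 'I_n -> {RV P >-> R}) (w : T) :
    rel 'I_n :=
  fun i j => if (i < j)%N then U i j w <= g (X i w, X j w)
             else if (j < i)%N then U j i w <= g (X j w, X i w)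
             else false.

End Probability.

Section Laplacian.
Variables (K : comNzRingType) (n : nat) (G : rel 'I_n).

Definition adjacency_mx : 'M[K]_n := \matrix_(i, j) (G i j)%:R.
Definition degree_mx : 'M[K]_n := diag_mx (\row_i (#|[pred j | G i j]|)%:R).
Definition laplacian_mx : 'M[K]_n := degree_mx - adjacency_mx.

End Laplacian.

Section Determinant.
Variables (R : realType) (n : nat) (p : R) (z : R[i]) (eps : 'I_n -> R).

Definition DL (G : rel 'I_n) : R[i] :=
  \det ((1 + p%:C * z)%:M + z *: diag_mx (\row_i (eps i)%:C)
        - z *: (n%:R^-1 *: laplacian_mx R[i] G)).

(* The second branch is the polynomial obtained from the first one by clearing
   the denominators. *)
Definition DL_mean : R[i] :=
  if [forall i, 1 + (eps i)%:C * z != 0] then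
    (\prod_(i < n) (1 + (eps i)%:C * z)) *
    (n%:R^-1 * \sum_(i < n)
       (1 + p%:C * z + (eps i)%:C * z) / (1 + (eps i)%:C * z))
  else
    n%:R^-1 * \sum_(i < n)
      (1 + p%:C * z + (eps i)%:C * z) *
        \prod_(j < n | j != i) (1 + (eps j)%:C * z).

End Determinant.

(* Main.v *)
Require Import Defs.
From HB Require Import structures.
From mathcomp Require Import all_boot all_order all_algebra.
From mathcomp Require Import all_classical all_reals all_analysis.
From mathcomp Require Import complex.
From mathcomp Require Import measurable_realfun ring.

Set Implicit Arguments.
Unset Strict Implicit.
Unset Printing Implicit Defensive.

Import Order.TTheory GRing.Theory Num.Theory.
Import numFieldNormedType.Exports.

Local Open Scope classical_set_scope.
Local Open Scope complex_scope.
Local Open Scope ring_scope.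

(** Only one instance of singularity is needed, the one where both graphs are a
    single edge.  It says that the degree function d(x) = int g(x, y) dy has
    second moment p^2; as its mean is p, its variance vanishes and d = p almost
    everywhere ([singular_regular]).

    The expected determinant then depends on the graphon through p alone.  The
    matrix is a grounded Laplacian: its row i is
      y_i e_i + c sum_(j <> i) A_ij (e_i - e_j),
    where y_i = 1 + pz + eps_i z and c = - z / n.  Expanding the determinant
    along all its rows at once gives a sum over maps f from the vertices to
    themselves, where f i = i means that row i contributes y_i e_i, and f i = j
    that it contributes c A_ij (e_i - e_j) ([det_grounded_laplacian]).  If f has
    a cycle of length at least two, the rows of that cycle add up to 0 and the
    term vanishes ([forest_coef_cyclic]).  Otherwise the pairs {i, f i} form a
    forest rooted at the fixed points of f.  Such a forest with m edges is
    contained in the random graph with probability p^m: a leaf i hangs from f i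
    by an edge that is independent of all the others once the type of f i is
    known, and that is present with conditional probability d(X_(f i)) = p
    ([leaf_step], [forest_probability]).

    So the expectation is the sum over f in which every A_ij has become p, which
    is the determinant of the grounded Laplacian with all weights equal to p:
    a diagonal matrix plus a constant one, whose determinant is explicit
    ([det_diag_add_const]).

    The independence used for leaves is the freezing lemma: if Y_a is independent
    of a sigma-algebra S, the pair formed by Y_a and the identity of the sample
    space equipped with S has the product law, so that Y_a can be integrated out
    first ([freezing]). *)

(** * Determinants and rooted forests *)

Lemma det_row_expansion (R : comNzRingType) (n : nat) (c : 'I_n -> 'I_n -> R)
    (v : 'I_n -> 'I_n -> 'rV[R]_n) :
  \det (\matrix_i \sum_j c i j *: v i j) =
  \sum_(f : {ffun 'I_n -> 'I_n})
     (\prod_i c i (f i)) * \det (\matrix_i v i (f i)).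
Proof.
rewrite /determinant; under [RHS]eq_bigr do rewrite mulr_sumr.
rewrite exchange_big/=; apply: eq_bigr => s _.
under [in RHS]eq_bigr do rewrite mulrCA -big_split/=.
rewrite -mulr_sumr; congr (_ * _).
under eq_bigr do rewrite mxE summxE.
rewrite bigA_distr_bigA/=; apply: eq_bigr => f _; apply: eq_bigr => i _.
by rewrite !mxE.
Qed.

(** By induction on the size, splitting the first row into its diagonal part,
    which leaves a matrix of the same shape, and its constant part, which clears
    the constant from the other rows. *)
Lemma det_diag_add_const (R : comNzRingType) (q : R) (n : nat) (b : 'I_n -> R) :
  \det (\matrix_(i < n, j < n) (b i *+ (i == j) + q)) =
  \prod_i b i + q * \sum_i \prod_(j | j != i) b j.
Proof.
elim: n b => [|n IHn] b; first by rewrite det_mx00 !big_ord0 mulr0 addr0.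
set M := \matrix_(_, _) _.
pose B := \matrix_(i < n.+1, j < n.+1)
  if i == 0 then (j == 0)%:R else b i *+ (i == j) + q.
pose C := \matrix_(i < n.+1, j < n.+1)
  if i == 0 then 1 else b i *+ (i == j) + q.
have detB : \det B = \prod_i b (lift ord0 i)
    + q * \sum_i \prod_(j | j != i) b (lift ord0 j).
  rewrite (expand_det_row _ 0) big_ord_recl big1 ?addr0 => [|i _]; last first.
    by rewrite mxE eqxx -(inj_eq val_inj)/= mul0r.
  rewrite mxE !eqxx mul1r /cofactor expr0 mul1r -IHn; congr (\det _).
  by apply/matrixP => i j; rewrite !mxE/= (inj_eq lift_inj).
have detC : \det C = \prod_i b (lift ord0 i).
  (* subtracting q times the row of ones from the other rows leaves D *)
  pose L : 'M[R]_(1 + n) := block_mx 1%:M 0 (const_mx q) 1%:M.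
  pose D : 'M[R]_(1 + n) :=
    block_mx 1%:M (const_mx 1) 0 (diag_mx (\row_i b (lift ord0 i))).
  have -> : \det C = \det (L *m D).
    congr (\det _); rewrite /L /D mulmx_block !(mul0mx, mulmx0, mul1mx, mulmx1, addr0).
    rewrite -[LHS](@submxK _ 1 n 1 n); apply: (f_equal4 (@block_mx R 1 n 1 n));
    apply/matrixP => i j; rewrite !mxE/=.
    - by rewrite !ord1.
    - by rewrite -(inj_eq val_inj)/= ord1.
    - by rewrite -!(inj_eq val_inj)/= !ord1/= mulr0n add0r.
    - rewrite big_ord1 !mxE mulr1 addrC.
      have -> : rshift 1 i = lift ord0 i by apply: val_inj.
      have -> : rshift 1 j = lift ord0 j by apply: val_inj.
      by rewrite /= (inj_eq lift_inj).
  rewrite det_mulmx det_lblock det_ublock !det1 !mul1r det_diag.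
  by apply: eq_bigr => i _; rewrite mxE.
have -> : \det M = b 0 * \det B + q * \det C.
  apply: (@determinant_multilinear _ _ _ _ _ 0).
  - apply/rowP => j; rewrite !mxE/= mulr1 eq_sym.
    by case: eqP => _; rewrite ?mulr1n ?mulr1 ?mulr0n ?mulr0.
  - by apply/matrixP => i j; rewrite !mxE eq_sym (negbTE (neq_lift _ _)).
  - by apply/matrixP => i j; rewrite !mxE eq_sym (negbTE (neq_lift _ _)).
rewrite detB detC big_ord_recl mulrDr -addrA; congr (_ + _).
rewrite big_ord_recl mulrDr addrC; congr (q * _ + _).
  by rewrite [RHS]big_mkcond [RHS]big_ord_recl eqxx/= mul1r; apply: eq_bigr.
rewrite mulrCA; congr (_ * _); rewrite mulr_sumr; apply: eq_bigr => i _.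
rewrite [RHS]big_mkcond big_ord_recl/=; congr (_ * _).
by rewrite [LHS]big_mkcond; apply: eq_bigr => j _; rewrite (inj_eq lift_inj).
Qed.

Section GroundedLaplacian.
Variables (K : fieldType) (n : nat).
Implicit Types (y : 'I_n -> K) (a : 'I_n -> 'I_n -> K) (f : 'I_n -> 'I_n).

(** The diagonal value is the row of a root, the others are oriented edges. *)
Definition arrow_row (i j : 'I_n) : 'rV[K]_n :=
  if j == i then delta_mx 0 i else delta_mx 0 i - delta_mx 0 j.

Definition arrow_mx f : 'M[K]_n := \matrix_i arrow_row i (f i).

Definition grounded_laplacian y (c : K) a : 'M[K]_n :=
  \matrix_i \sum_j (if j == i then y i else c * a i j) *: arrow_row i j.

Definition forest_coef y (c : K) f : K :=
  (\prod_i if f i == i then y i else c) * \det (arrow_mx f).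

(** The sum over maps f contains the forests rooted at the fixed
    points of f, and terms with cycles that [forest_coef_cyclic] removes.
    Keeping the latter makes this a plain multilinear expansion. *)
Lemma det_grounded_laplacian y c a :
  \det (grounded_laplacian y c a) =
  \sum_(f : {ffun 'I_n -> 'I_n})
    forest_coef y c f * \prod_(i | f i != i) a i (f i).
Proof.
rewrite det_row_expansion; apply: eq_bigr => f _.
rewrite /forest_coef mulrAC; congr (_ * _).
rewrite [X in _ = _ * X]big_mkcond -big_split/=; apply: eq_bigr => i _.
by case: eqP => _ /=; rewrite ?mulr1.
Qed.

(** On a set S that f permutes without fixed points, the rows e_i - e_(f i) add
    up to 0.  By finiteness it is enough that S is contained in its image. *)
Lemma forest_coef_cyclic y c f (S : {set 'I_n}) :
  S != finset.set0 -> (forall i, i \in S -> f i != i) -> S \subset f @: S ->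
  forest_coef y c f = 0.
Proof.
move=> S0 Sfix Sf; rewrite /forest_coef; suff -> : \det (arrow_mx f) = 0 by rewrite mulr0.
have fS : f @: S = S.
  by apply/esym/eqP; rewrite eqEcard Sf leq_imset_card.
have finj : {in S &, injective f} by apply/imset_injP; rewrite fS.
apply/eqP/det0P; exists (\row_i (i \in S)%:R).
  have /set0Pn[i iS] := S0; apply/eqP => /rowP/(_ i).
  by rewrite !mxE iS => /eqP; rewrite oner_eq0.
rewrite mulmx_sum_row (eq_bigr (fun i => if i \in S then
   delta_mx 0 i - delta_mx 0 (f i) else 0)); last first.
  move=> i _; rewrite mxE rowK /arrow_row.
  have [iS|_] := boolP (i \in S); last by rewrite scale0r.
  by rewrite (negbTE (Sfix _ iS)) scale1r.
rewrite -big_mkcond sumrB/= -[X in X - _]/(\sum_(i in S) _) -{1}fS.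
by rewrite big_imset// subrr.
Qed.

Lemma grounded_laplacianE y c a i j : grounded_laplacian y c a i j =
  (y i + c * \sum_(k | k != i) a i k) *+ (i == j) - (c * a i j) *+ (i != j).
Proof.
rewrite mxE summxE (bigD1 i)//= /arrow_row eqxx !mxE eqxx/=.
rewrite (eq_bigr (fun k => (c * a i k) *+ (i == j)
    - (c * a i k) *+ (k == j))); last first.
  move=> k ki; rewrite (negbTE ki) !mxE eqxx/= mulrBr ![j == _]eq_sym.
  by rewrite !mulr_natr.
rewrite sumrB [j == i]eq_sym mulr_natr mulrnDl mulr_sumr sumrMnl addrA.
congr (_ - _); case: (eqVneq i j) => [<-|ij].
  by rewrite big1// => k /negbTE ->.
rewrite (bigD1 j) 1?eq_sym//= eqxx big1 ?addr0// => k.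
by case/andP=> _ /negbTE ->.
Qed.

Lemma det_grounded_laplacian_const y c p :
  \det (grounded_laplacian y c (fun _ _ => p)) =
  let b i := y i + n%:R * (c * p) in
  \prod_i b i - c * p * \sum_i \prod_(j | j != i) b j.
Proof.
rewrite /= -mulNr -det_diag_add_const; congr (\det _).
apply/matrixP => i j; rewrite grounded_laplacianE mxE.
have -> : n%:R = 1 + \sum_(k < n | k != i) 1 :> K.
  by rewrite -[LHS]mulr1 -[in LHS](card_ord n) mulr_natl -sumr_const (bigD1 i).
rewrite (eq_bigr (fun k => p * 1)) => [|k _]; last by rewrite mulr1.
rewrite -mulr_sumr.
by case: eqP => _ /=; rewrite ?mulr1n ?mulr0n; ring.
Qed.

End GroundedLaplacian.

(** * Integrating out an independent variable *)

Section Freezing.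
Context d (T : measurableType d) (R : realType) (P : probability T R).
Variables (I : finType) (Y : I -> {RV P >-> R}) (a : I).

(** A pi-system that generates the sigma-algebra of the variables Y_i, i <> a. *)
Definition other_cylinders : set (set T) :=
  [set A | exists2 B : I -> set R, forall i, measurable (B i) &
    A = \bigcap_(i in [set` [set~ a]%SET]) Y i @^-1` B i].

(** The sample space with that smaller sigma-algebra.  Measurability on this type
    expresses that an event or a variable does not involve Y_a. *)
Definition othersType := g_sigma_algebraType other_cylinders.
HB.instance Definition _ := Measurable.on othersType.

Lemma measurable_preimageY i (B : set R) :
  measurable B -> d.-measurable (Y i @^-1` B).
Proof. by move=> mB; rewrite -[_ @^-1` _]setTI; exact: measurable_funP. Qed.

Lemma other_cylinders_measurable A : other_cylinders A -> d.-measurable A.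
Proof.
case=> B mB ->; apply: fin_bigcap_measurable => // i _.
exact: measurable_preimageY.
Qed.

Lemma othersType_measurable (A : set T) :
  measurable (A : set othersType) -> d.-measurable A.
Proof.
apply: smallest_sub; last exact: other_cylinders_measurable.
exact: sigma_algebra_measurable.
Qed.

Lemma measurable_others (b : I) :
  b != a -> measurable_fun setT (Y b : othersType -> R).
Proof.
move=> ba _ B mB; rewrite setTI; apply: sub_sigma_algebra.
exists (fun i => if i == b then B else setT) => [i|]; first by case: ifP.
apply/seteqP; split=> [w /= YB i _ /=|w /= /(_ b)/=]; last first.
  by rewrite eqxx; apply; rewrite !inE.
by case: eqP => [->|].
Qed.

Hypothesis Yind : mutually_independent Y.

(** Both sides are finite measures in E that agree on the cylinders. *)
Lemma others_indep (E : set othersType) (C : set R) :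
  measurable E -> measurable C ->
  P (E `&` Y a @^-1` C) = (P (Y a @^-1` C) * P E)%E.
Proof.
move=> mE mC; have mYC := measurable_preimageY a mC.
have Pfin (A : set T) : d.-measurable A -> P A \is a fin_num.
  by move=> mA; rewrite fin_num_measure.
pose m1 : {measure set T -> \bar R} := mrestr P mYC.
pose m2 : {measure set T -> \bar R} :=
  mscale (NngNum (fine_ge0 (measure_ge0 P (Y a @^-1` C)))) P.
have m2E A : m2 A = (P (Y a @^-1` C) * P A)%E.
  by rewrite /m2/= /mscale/= fineK// Pfin.
rewrite -m2E -[LHS]/(m1 E).
apply: (@g_sigma_algebra_measure_unique _ _ _ other_cylinders _ (fun=> setT) _ _ m1 m2) => //.
- exact: other_cylinders_measurable.
- move=> _; exists (fun=> setT) => //.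
  by apply/esym/seteqP; split.
- by apply/seteqP; split => // w _; exists 0%N.
- move=> _ _ [B1 mB1 ->] [B2 mB2 ->]; exists (fun i => B1 i `&` B2 i).
    by move=> i; exact: measurableI.
  apply/seteqP; split=> w /=; first by move=> [h1 h2] i ia; split; [exact: h1|exact: h2].
  by move=> h; split=> i ia; have [] := h i ia.
- move=> _ [B mB ->]; rewrite m2E /m1/= /mrestr/=.
  have -> : \bigcap_(i in [set` [set~ a]%SET]) Y i @^-1` B i `&` Y a @^-1` C =
      \bigcap_(i in [set` [set: I]%SET])
        Y i @^-1` (if i == a then C else B i).
    apply/seteqP; split=> w /=.
      move=> [h YC] i _ /=; case: eqP => [->//|/eqP ia].
      by apply: h; rewrite /= !inE.
    move=> h; split=> [i|]; last by have := h a; rewrite /= eqxx; apply; rewrite inE.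
    by rewrite /= !inE => ia; have := h i; rewrite /= (negbTE ia); apply; rewrite inE.
  rewrite !Yind// => [|i]; last by case: ifP.
  rewrite (bigD1 a) ?inE//= eqxx; congr (_ * _)%E.
  apply: eq_big => i; rewrite !inE//= => /negbTE -> //.
- move=> _; rewrite /m1/= /mrestr setTI; apply: le_lt_trans (ltry 1).
  exact: probability_le1.
Qed.

(** The pair (Y_a, identity) has the product law on R * othersType by
    [others_indep], and Tonelli applies. *)
Lemma freezing (f : R * othersType -> \bar R) :
  measurable_fun setT f -> (forall x, 0 <= f x)%E ->
  (\int[P]_w f (Y a w, w) =
   \int[P]_w \int[distribution P (Y a)]_y f (y, w))%E.
Proof.
move=> mf f0.
have mid : measurable_fun setT (idfun : T -> othersType).
  by move=> _ B mB; rewrite setTI; exact: othersType_measurable.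
have mjoint : measurable_fun setT (fun w : T => (Y a w, w : othersType)).
  exact: measurable_fun_pair.
pose idm : {mfun T >-> othersType} :=
  HB.pack (idfun : T -> othersType) (isMeasurableFun.Build _ _ _ _ _ mid).
pose joint : {mfun T >-> (R * othersType)%type} :=
  HB.pack (fun w : T => (Y a w, w : othersType))
    (isMeasurableFun.Build _ _ _ _ _ mjoint).
transitivity (\int[distribution P joint]_x f x)%E.
  by rewrite ge0_integral_distribution.
transitivity (\int[distribution P (Y a) \x distribution P idm]_x f x)%E.
  apply: eq_measure_integral => A mA _.
  apply/esym/product_measure_unique => // B C mB mC.
  rewrite -others_indep//; congr (P _).
  by apply/seteqP; split=> w /= [].
rewrite fubini_tonelli2// ge0_integral_distribution//.
- exact: measurable_fun_fubini_tonelli_G.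
- by move=> w; apply: integral_ge0.
Qed.

End Freezing.

(** * Integration over cubes *)

Section CubeIntegral.
Variable R : realType.

Lemma integral_cube0 (h : 0.-tuple R -> \bar R) :
  measurable_fun setT h -> (\int[cube_prob R 0]_t h t = h [tuple])%E.
Proof. by move=> mh; rewrite /= integral_dirac// diracT mul1e. Qed.

Lemma integral_cubeS k (h : k.+1.-tuple R -> \bar R) :
  measurable_fun setT h -> (forall t, 0 <= h t)%E ->
  (\int[cube_prob R k.+1]_t h t =
   \int[@unif01 R]_x \int[cube_prob R k]_t h (tcons (x, t)))%E.
Proof.
move=> mh h0; rewrite ge0_integral_distribution//.
rewrite fubini_tonelli1//=; apply: (measurableT_comp mh).
exact: measurable_tcons.
Qed.

Lemma measurable_cons_slice k (h : k.+1.-tuple R -> \bar R) x :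
  measurable_fun setT h -> measurable_fun setT (fun t => h (tcons (x, t))).
Proof.
move=> mh; apply: measurableT_comp => //.
by apply: measurableT_comp => //; exact: measurable_tcons.
Qed.

Lemma integral_cube3 (h : 3.-tuple R -> \bar R) :
  measurable_fun setT h -> (forall t, 0 <= h t)%E ->
  (\int[cube_prob R 3]_t h t =
   \int[@unif01 R]_x \int[@unif01 R]_y \int[@unif01 R]_z h [tuple x; y; z])%E.
Proof.
move=> mh h0; rewrite integral_cubeS//; apply: eq_integral => x _.
have mx := measurable_cons_slice x mh.
rewrite integral_cubeS//; apply: eq_integral => y _.
have my := measurable_cons_slice y mx.
rewrite integral_cubeS//; apply: eq_integral => z _.
rewrite integral_cube0; last exact: measurable_cons_slice my.
by congr h; apply: val_inj.
Qed.

Lemma integral_cube4 (h : 4.-tuple R -> \bar R) :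
  measurable_fun setT h -> (forall t, 0 <= h t)%E ->
  (\int[cube_prob R 4]_t h t =
   \int[@unif01 R]_x \int[@unif01 R]_y \int[@unif01 R]_z \int[@unif01 R]_w
     h [tuple x; y; z; w])%E.
Proof.
move=> mh h0; rewrite integral_cubeS//; apply: eq_integral => x _.
have mx := measurable_cons_slice x mh.
by rewrite integral_cube3.
Qed.

End CubeIntegral.

(** * The degree function of a graphon *)

Section ZeroExtension.
Variables (R : realType) (g : graph_function R).
Local Notation u := (@unif01 R).

(** With value 0 outside the unit square, integrals over cubes become integrals
    over the whole space. *)
Definition kernel01 : R * R -> R := (g : R * R -> R) \_ (unit_square R).

Lemma measurable_unit_square : measurable (unit_square R).
Proof. by apply: measurableX; exact: measurable_itv. Qed.

Lemma measurable_kernel01 : measurable_fun setT kernel01.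
Proof.
exact: (measurable_restrictT g measurable_unit_square).1 (gf_measurable g).
Qed.

Lemma kernel01E x y : unit_square R (x, y) -> kernel01 (x, y) = g (x, y).
Proof. by move=> xy; rewrite /kernel01 patchE mem_set. Qed.

Lemma kernel01_out x y : ~ unit_square R (x, y) -> kernel01 (x, y) = 0.
Proof. by move=> xy; rewrite /kernel01 patchE memNset. Qed.

Lemma kernel01_ge0 x : 0 <= kernel01 x.
Proof.
case: x => x y; have [xy|xy] := pselect (unit_square R (x, y)).
  by rewrite kernel01E//; case/andP: (gf_range g xy).
by rewrite kernel01_out.
Qed.

Lemma kernel01_le1 x : kernel01 x <= 1.
Proof.
case: x => x y; have [xy|xy] := pselect (unit_square R (x, y)).
  by rewrite kernel01E//; case/andP: (gf_range g xy).
by rewrite kernel01_out.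
Qed.

Lemma kernel01_sym x y : kernel01 (x, y) = kernel01 (y, x).
Proof.
have [xy|xy] := pselect (unit_square R (x, y)).
  by rewrite !kernel01E//; [exact: (gf_sym g)|case: xy].
by rewrite !kernel01_out// => -[? ?]; apply: xy.
Qed.

Definition degree (x : R) : R := (\int[u]_(y in setT) kernel01 (x, y))%R.

Lemma measurable_kernel01l x : measurable_fun setT (fun y => kernel01 (x, y)).
Proof. by apply: measurableT_comp; [exact: measurable_kernel01|]. Qed.

Lemma measurable_kernel01_comp d (T : measurableType d) (X Y : T -> R) :
  measurable_fun setT X -> measurable_fun setT Y ->
  measurable_fun setT (fun w => kernel01 (X w, Y w)).
Proof.
move=> mX mY; apply: (measurableT_comp measurable_kernel01).
exact: measurable_fun_pair.
Qed.

Lemma integral_unit_fine d (T : measurableType d) (P : probability T R)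
    (f : T -> \bar R) : measurable_fun setT f ->
  (forall x, 0 <= f x)%E -> (forall x, f x <= 1)%E ->
  [/\ (\int[P]_x f x)%E \is a fin_num, (0 <= \int[P]_x f x)%E
    & (\int[P]_x f x <= 1)%E].
Proof.
move=> mf f0 f1.
have I0 : (0 <= \int[P]_x f x)%E by apply: integral_ge0.
have I1 : (\int[P]_x f x <= 1)%E.
  apply: (@le_trans _ _ (\int[P]_x cst 1 x)%E).
    by apply: ge0_le_integral => //.
  by rewrite integral_cst// mul1e probability_le1.
by split=> //; rewrite ge0_fin_numE//; exact: le_lt_trans I1 (ltry _).
Qed.

Lemma integral_kernel01 x : (\int[u]_y (kernel01 (x, y))%:E = (degree x)%:E)%E.
Proof.
rewrite /degree /Rintegral fineK//.
case: (@integral_unit_fine _ _ u (fun y => (kernel01 (x, y))%:E)) => //.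
- apply/measurable_EFinP; exact: measurable_kernel01l.
- by move=> y; rewrite lee_fin kernel01_ge0.
- by move=> y; rewrite lee_fin kernel01_le1.
Qed.

Lemma degree_ge0 x : 0 <= degree x.
Proof.
rewrite -lee_fin -integral_kernel01; apply: integral_ge0 => y _.
by rewrite lee_fin kernel01_ge0.
Qed.

Lemma degree_le1 x : degree x <= 1.
Proof.
rewrite -lee_fin -integral_kernel01.
case: (@integral_unit_fine _ _ u (fun y => (kernel01 (x, y))%:E)) => //.
- apply/measurable_EFinP; exact: measurable_kernel01l.
- by move=> y; rewrite lee_fin kernel01_ge0.
- by move=> y; rewrite lee_fin kernel01_le1.
Qed.

Lemma measurable_degree : measurable_fun setT degree.
Proof.
apply/measurable_EFinP.
rewrite (_ : EFin \o degree =
   fubini_F u (fun z : R * R => (kernel01 z)%:E)); last first.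
  by apply/funext => x; rewrite /= -integral_kernel01.
apply: measurable_fun_fubini_tonelli_F => [|x].
  apply/measurable_EFinP; exact: measurable_kernel01.
by rewrite lee_fin kernel01_ge0.
Qed.

Lemma integral_degree : (\int[u]_x (degree x)%:E = (edge_density g)%:E)%E.
Proof.
have E : (\int[(u \x u)%E]_(z in unit_square R) (g z)%:E =
    \int[u]_x (degree x)%:E)%E.
  rewrite integral_mkcond restrict_EFin -/kernel01 fubini_tonelli1.
  - by apply: eq_integral => x _; rewrite -integral_kernel01.
  - apply/measurable_EFinP; exact: measurable_kernel01.
  - by move=> x; rewrite lee_fin kernel01_ge0.
rewrite /edge_density /Rintegral E fineK//.
case: (@integral_unit_fine _ _ u (fun x => (degree x)%:E)) => //.
- apply/measurable_EFinP; exact: measurable_degree.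
- by move=> y; rewrite lee_fin degree_ge0.
- by move=> y; rewrite lee_fin degree_le1.
Qed.

End ZeroExtension.

(** * Singular graphons are regular *)

Fact edge_graph_sym : symmetric (fun i j : 'I_2 => i != j).
Proof. by move=> i j; rewrite eq_sym. Qed.

Fact edge_graph_irr : irreflexive (fun i j : 'I_2 => i != j).
Proof. by move=> i; rewrite eqxx. Qed.

Definition edge_graph : simple_graph 2 := SimpleGraph edge_graph_sym edge_graph_irr.

Lemma disj_union_edges (a b : 'I_(2 + 2)) :
  (a < b)%N && disj_union edge_graph edge_graph a b =
  ((val a == 0%N) && (val b == 1%N)) || ((val a == 2%N) && (val b == 3%N)).
Proof.
rewrite /disj_union/= /disj_union_rel.
case: (fintype.splitP a) => i ->; case: (fintype.splitP b) => j -> /=;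
 by case: i => [[|[|//]] ?]; case: j => [[|[|//]] ?].
Qed.

Lemma glue_edges (i1 i2 : 'I_2) (a b : 'I_(2 + 1)) :
  (a < b)%N && Defs.glue edge_graph edge_graph i1 i2 a b =
  ((val a == 0%N) && (val b == 1%N)) || ((val a == val i1) && (val b == 2%N)).
Proof.
have E (x : 'I_2) : x = 0 \/ x = 1.
  by case: x => [[|[|//]] ?]; [left|right]; apply: val_inj.
apply/andP/orP => [[ab /orP[]]|].
- case/existsP => x /existsP[y /and3P[xy /eqP aE /eqP bE]]; left.
  by move: ab xy; rewrite aE bE; case: (E x) => ->; case: (E y) => ->.
- case/existsP => x /existsP[y /and3P[xy /eqP aE /eqP bE]]; right.
  move: ab xy; rewrite aE bE /glue_r.
  case: (unliftP i2 x) => [x' ->|->]; case: (unliftP i2 y) => [y' ->|->] //=;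
    rewrite ?ord1 ?eqxx//= ?addn0.
  by case: (E i1) => ->.
- move=> H; split.
    by case: H => /andP[/eqP -> /eqP ->] //; case: (E i1) => ->.
  apply/orP; case: H => /andP[/eqP aE /eqP bE]; [left|right].
    apply/existsP; exists 0; apply/existsP; exists 1; rewrite /=.
    by rewrite -!(inj_eq val_inj) aE bE.
  apply/existsP; exists i2; apply/existsP; exists (lift i2 ord0).
  rewrite /= neq_lift /glue_r unlift_none liftK.
  by rewrite -!(inj_eq val_inj) aE bE/= !eqxx.
Qed.

Section Regularity.
Variables (R : realType) (g : graph_function R).
Local Notation u := (@unif01 R).
Local Notation W := (kernel01 g).
Local Notation p := (edge_density g).

(** Every vertex lies on an edge, so the product of the extended kernels vanishes
    outside the cube and the restriction to the cube can be dropped. *)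
Lemma hom_density_two_edges k (F : simple_graph k) (a b c e : 'I_k) :
  (forall i j : 'I_k, (i < j)%N && F i j = ((i, j) == (a, b)) || ((i, j) == (c, e))) ->
  (a, b) != (c, e) -> (forall i, i \in [:: a; b; c; e]) ->
  hom_density g F = fine (\int[cube_prob R k]_t
    (W (tnth t a, tnth t b) * W (tnth t c, tnth t e))%:E)%E.
Proof.
move=> FE abce cov; rewrite /hom_density /Rintegral integral_mkcond.
congr fine; apply: eq_integral => t _; rewrite patchE.
rewrite (eq_bigl (mem [:: (a, b); (c, e)])); last first.
  by case=> i j; rewrite FE !inE.
rewrite -big_uniq/=; last by rewrite inE abce.
rewrite !big_cons big_nil mulr1/=; case: ifPn => [|tout].
  by rewrite inE => tin; rewrite !kernel01E//; split; exact: tin.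
suff : W (tnth t a, tnth t b) = 0 \/ W (tnth t c, tnth t e) = 0.
  by case=> ->; rewrite ?mulr0 ?mul0r.
have [ab|ab] := pselect (unit_square R (tnth t a, tnth t b)); last first.
  by left; rewrite kernel01_out.
have [ce|ce] := pselect (unit_square R (tnth t c, tnth t e)); last first.
  by right; rewrite kernel01_out.
move: tout; rewrite notin_setE => -[] i; case: ab => ? ?; case: ce => ? ?.
by have := cov i; rewrite !inE => /or4P[] /eqP ->.
Qed.

Lemma measurable_two_edges k (a b c e : 'I_k) : measurable_fun setT
  (fun t : k.-tuple R => (W (tnth t a, tnth t b) * W (tnth t c, tnth t e))%:E).
Proof.
apply/measurable_EFinP; apply: measurable_funM;
  by apply: measurable_kernel01_comp; exact: measurable_tnth.
Qed.

Lemma two_edges_ge0 k (a b c e : 'I_k) (t : k.-tuple R) :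
  (0 <= (W (tnth t a, tnth t b) * W (tnth t c, tnth t e))%:E)%E.
Proof. by rewrite lee_fin mulr_ge0 ?kernel01_ge0. Qed.

Lemma integral_kernel01_scale (r x : R) : 0 <= r ->
  (\int[u]_y (r * W (x, y))%:E = (r * degree g x)%:E)%E.
Proof.
move=> r0; under eq_integral do rewrite EFinM.
rewrite ge0_integralZl_EFin//.
- by rewrite integral_kernel01.
- by move=> y _; rewrite lee_fin kernel01_ge0.
- by apply/measurable_EFinP; exact: measurable_kernel01l.
Qed.

Lemma edge_density_ge0 : 0 <= p.
Proof.
rewrite -lee_fin -integral_degree; apply: integral_ge0 => x _.
by rewrite lee_fin degree_ge0.
Qed.

(** The two edges share no coordinate, so the integral factors as p * p. *)
Lemma hom_density_disj_union_edge :
  hom_density g (disj_union edge_graph edge_graph) = p ^+ 2.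
Proof.
rewrite (@hom_density_two_edges _ _ 0 1 (inord 2) (inord 3)).
- rewrite integral_cube4; [|exact: measurable_two_edges|exact: two_edges_ge0].
  have -> : (\int[u]_x \int[u]_y \int[u]_z \int[u]_w
     (W (tnth [tuple x; y; z; w] 0, tnth [tuple x; y; z; w] 1) *
      W (tnth [tuple x; y; z; w] (inord 2), tnth [tuple x; y; z; w] (inord 3)))%:E
     = \int[u]_x \int[u]_y (p * W (x, y))%:E)%E.
    apply: eq_integral => x _; apply: eq_integral => y _.
    rewrite mulrC EFinM -integral_degree -ge0_integralZl_EFin//.
    + apply: eq_integral => z _; rewrite -EFinM.
      rewrite -integral_kernel01_scale ?kernel01_ge0//.
      by apply: eq_integral => w _; rewrite !(tnth_nth 0) !inordK.
    + by move=> z _; rewrite lee_fin degree_ge0.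
    + by apply/measurable_EFinP; exact: measurable_degree.
    + exact: kernel01_ge0.
  have p0 := edge_density_ge0.
  under eq_integral do rewrite integral_kernel01_scale//.
  under eq_integral do rewrite EFinM.
  rewrite ge0_integralZl_EFin//; first by rewrite integral_degree.
  + by move=> z _; rewrite lee_fin degree_ge0.
  + by apply/measurable_EFinP; exact: measurable_degree.
- move=> i j; rewrite disj_union_edges !xpair_eqE -!(inj_eq val_inj)/=.
  by rewrite !inordK.
- by rewrite xpair_eqE -!(inj_eq val_inj)/= !inordK.
- move=> i; rewrite !inE -!(inj_eq val_inj)/= !inordK//.
  by case: i => [[|[|[|[|]]]] ?].
Qed.

(** Gluing two edges always gives a path with two edges; the integral over its
    two ends leaves the squared degree of the middle vertex. *)
Lemma hom_density_glue_edge (i1 i2 : 'I_2) :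
  hom_density g (Defs.glue edge_graph edge_graph i1 i2) =
  fine (\int[u]_x ((degree g x) ^+ 2)%:E)%E.
Proof.
rewrite (@hom_density_two_edges _ _ 0 (inord 1) (inord i1) (inord 2)).
- rewrite integral_cube3; [|exact: measurable_two_edges|exact: two_edges_ge0].
  congr fine.
  (* the middle vertex is the first coordinate if i1 = 0, else the second *)
  have [->|->] : i1 = 0 \/ i1 = 1.
    by case: i1 => [[|[|//]] ?]; [left|right]; apply: val_inj.
  + apply: eq_integral => x _.
    transitivity (\int[u]_y (degree g x * W (x, y))%:E)%E; last first.
      by rewrite integral_kernel01_scale ?degree_ge0.
    apply: eq_integral => y _.
    rewrite mulrC -integral_kernel01_scale ?kernel01_ge0//.
    by apply: eq_integral => z _; rewrite !(tnth_nth 0) !inordK.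
  + transitivity (\int[u]_x \int[u]_y (W (x, y) * degree g y)%:E)%E.
      apply: eq_integral => x _; apply: eq_integral => y _.
      rewrite -integral_kernel01_scale ?kernel01_ge0//.
      by apply: eq_integral => z _; rewrite !(tnth_nth 0) !inordK.
    rewrite (@fubini_tonelli _ _ _ _ _ u u
       (fun xy : R * R => (W xy * degree g xy.2)%:E)).
    * apply: eq_integral => y _ /=.
      transitivity (\int[u]_x (degree g y * W (y, x))%:E)%E.
        by apply: eq_integral => x _; rewrite kernel01_sym mulrC.
      by rewrite integral_kernel01_scale ?degree_ge0.
    * apply/measurable_EFinP; apply: measurable_funM.
        exact: measurable_kernel01.
      apply: measurableT_comp => //; exact: measurable_degree.
    * by move=> x; rewrite lee_fin mulr_ge0 ?kernel01_ge0 ?degree_ge0.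
- move=> i j; rewrite glue_edges !xpair_eqE -!(inj_eq val_inj)/=.
  by rewrite !inordK//; case: i1 => [[|[|]] ?].
- rewrite xpair_eqE -!(inj_eq val_inj)/= !inordK//=; first by rewrite andbC.
  by case: i1 => [[|[|]] ?].
- move=> i; rewrite !inE -!(inj_eq val_inj)/= !inordK//; last first.
    by case: i1 => [[|[|]] ?].
  by case: i => [[|[|[|]]] ?]//=; rewrite !orbT.
Qed.

(** Singularity for two edges gives int d^2 = p^2, hence int (d - p)^2 = 0. *)
Lemma singular_regular : singular g ->
  {ae u, forall x, degree g x = p}.
Proof.
move=> /(_ _ _ edge_graph edge_graph isT isT).
rewrite hom_density_disj_union_edge.
under eq_bigr do under eq_bigr do rewrite hom_density_glue_edge.
rewrite !sumr_const !card_ord.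
set D2 := (\int[u]_x _)%E => pD2.
have D0 x := degree_ge0 g x; have D1 x := degree_le1 g x.
have mD := measurable_degree g.
have mD2 : measurable_fun setT (fun x => ((degree g x) ^+ 2)%:E).
  by apply/measurable_EFinP; exact: measurable_funX.
have D2E : D2 = (p ^+ 2)%:E.
  rewrite pD2 -mulr_natl -[X in _ *+ X]mulr1 -mulr_natl.
  have [] // := @integral_unit_fine _ _ _ u _ mD2.
  - by move=> x; rewrite lee_fin sqr_ge0.
  - by move=> x; rewrite lee_fin expr_le1.
  move=> fin_D2 _ _; rewrite -[LHS](fineK fin_D2); congr (_%:E).
  by field.
have Icst r : (\int[u]_x cst r%:E x = r%:E)%E.
  rewrite integral_cst// -[RHS]mule1; congr (_ * _)%E.
  exact: probability_setT.
have p0 := edge_density_ge0.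
have mV : measurable_fun setT (fun x => ((degree g x - p) ^+ 2)%:E).
  apply/measurable_EFinP; apply: measurable_funX.
  by apply: measurable_funB.
have V0 : (\int[u]_x `|((degree g x - p) ^+ 2)%:E| = 0)%E.
  under eq_integral do rewrite /= ger0_norm ?sqr_ge0//.
  (* 2 p int d = 2 p^2 is added to both sides to keep all integrands nonnegative *)
  have E : (\int[u]_x ((degree g x - p) ^+ 2)%:E + (2 * p * p)%:E = (2 * p * p)%:E)%E.
    have {1}-> : ((2 * p * p)%:E = \int[u]_x (2 * p * degree g x)%:E)%E.
      rewrite EFinM -integral_degree -ge0_integralZl_EFin ?mulr_ge0//.
        by move=> x _; rewrite lee_fin.
      by apply/measurable_EFinP.
    rewrite -ge0_integralD//.
    - transitivity (\int[u]_x (((degree g x) ^+ 2)%:E + (cst (p ^+ 2)%:E) x))%E.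
        by apply: eq_integral => x _; rewrite -!EFinD; congr (_%:E); ring.
      rewrite ge0_integralD//.
      + by rewrite Icst -/D2 D2E -EFinD; congr (_%:E); ring.
      + by move=> x _; rewrite lee_fin sqr_ge0.
      + by move=> x _; rewrite lee_fin sqr_ge0.
    - by move=> x _; rewrite lee_fin sqr_ge0.
    - by move=> x _; rewrite lee_fin !mulr_ge0.
    - by apply/measurable_EFinP; exact: measurable_funM.
  move: E; case: (\int[u]_x _)%E => // r [] /eqP.
  by rewrite -subr_eq0 addrK => /eqP ->.
have /(ae_eq_integral_abs u measurableT mV) := V0.
apply: filterS => x /(_ I) /= [] /eqP.
by rewrite sqrf_eq0 subr_eq0 => /eqP.
Qed.

End Regularity.

(** * Forests in the random graph *)

Lemma unif01_le (R : realType) (c : R) : 0 <= c <= 1 ->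
  @unif01 R [set x | x <= c] = c%:E.
Proof.
move=> /andP[c0 c1].
have E : [set x | x <= c] = `]-oo, c]%classic by apply/seteqP; split => x /=; rewrite in_itv.
have mI : measurable (`]-oo, c]%classic : set R) by exact: measurable_itv.
rewrite E /unif01 -(setIT `]-oo, c]%classic) -integral_indic// integral_uniform//; last first.
  by apply/measurable_EFinP; exact: measurable_indic.
rewrite subr0 invr1 mul1e integral_indic//.
have -> : `]-oo, c]%classic `&` `[0, 1]%classic = `[0, c]%classic :> set R.
  apply/seteqP; split => x /=; rewrite !in_itv/=.
    by move=> [xc /andP[-> _]].
  by move=> /andP[x0 xc]; split=> //; rewrite x0 (le_trans xc).
transitivity (@lebesgue_measure R `[0, c]%classic) => //.
by rewrite lebesgue_measure_itv/= lte_fin lt_neqAle c0 andbT;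
  case: eqVneq => [<-|]//=; rewrite -EFinB subr0.
Qed.

Section LeafIntegration.
Variables (R : realType) (g : graph_function R).
Local Notation u := (@unif01 R).
Local Notation W := (kernel01 g).
Local Notation p := (edge_density g).
Hypothesis g_regular : {ae u, forall x, degree g x = p}.
Context d (T : measurableType d) (P : probability T R).
Variables (I : finType) (Y : I -> {RV P >-> R}).
Hypothesis Y_iid : iid_uniform01 Y.

Lemma integral_unif_law a (f : R -> \bar R) :
  (\int[distribution P (Y a)]_y f y = \int[u]_y f y)%E.
Proof.
by apply: eq_measure_integral => A mA _; have [_] := Y_iid.1 a; apply.
Qed.

Lemma measurable_below d' (T' : measurableType d') (V X1 X2 : T' -> R) :
  measurable_fun setT V -> measurable_fun setT X1 -> measurable_fun setT X2 ->
  measurable [set w | V w <= W (X1 w, X2 w)].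
Proof.
move=> mV m1 m2; rewrite -[X in measurable X]setTI.
have mb := measurable_fun_ler mV (measurable_kernel01_comp g m1 m2).
exact: (mb measurableT [set true]).
Qed.

(** Y_i is the type of the leaf, Y_j that of its neighbour, Y_b the variable that
    decides the edge between them.  The event B involves neither Y_i nor Y_b:
    integrating out Y_b turns the edge into W (Y_i, Y_j), integrating out Y_i then
    gives the degree of Y_j, which is p almost surely. *)
Lemma leaf_step (i j b : I) (B : set T) : i != j -> i != b -> j != b ->
  measurable (B : set (othersType Y i)) -> measurable (B : set (othersType Y b)) ->
  P (B `&` [set w | Y b w <= W (Y i w, Y j w)]) = (P B * p%:E)%E.
Proof.
move=> ij ib jb mBi mBb.
have mB : measurable B := othersType_measurable mBi.
have mC : measurable [set w | Y b w <= W (Y i w, Y j w)].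
  by apply: measurable_below; exact: measurable_funP.
have Yind := Y_iid.2.
have fmBb : measurable_fun setT (\1_B : othersType Y b -> R).
  exact: measurable_indic.
have ji : j != i by rewrite eq_sym.
have mYib : measurable_fun setT (Y i : othersType Y b -> R).
  exact: measurable_others.
have mYjb : measurable_fun setT (Y j : othersType Y b -> R).
  exact: measurable_others.
have mYji : measurable_fun setT (Y j : othersType Y i -> R).
  exact: measurable_others.
have fmBi : measurable_fun setT (\1_B : othersType Y i -> R).
  exact: measurable_indic.
transitivity (\int[P]_w (\1_B w * (Y b w <= W (Y i w, Y j w))%R%:R)%:E)%E.
  rewrite -[X in P X]setIT -integral_indic//; last exact: measurableI.
  apply: eq_integral => w _; rewrite indicI /= !indicE; congr (_ * (nat_of_bool _)%:R)%:E.
  by apply/idP/idP; rewrite inE.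
rewrite (@freezing _ _ _ _ _ _ b Yind
  (fun x => (\1_B x.2 * (x.1 <= W (Y i x.2, Y j x.2))%R%:R)%:E))/=; last 2 first.
- apply/measurable_EFinP; apply: measurable_funM.
    exact: (measurableT_comp fmBb measurable_snd).
  have mD : measurable [set x : R * othersType Y b | x.1 <= W (Y i x.2, Y j x.2)].
    apply: measurable_below => //.
    + exact: (measurableT_comp mYib measurable_snd).
    + exact: (measurableT_comp mYjb measurable_snd).
  rewrite (_ : (fun _ => _) = \1_[set x : R * othersType Y b | x.1 <= W (Y i x.2, Y j x.2)]).
    exact: measurable_indic.
  apply/funext => x; rewrite indicE; congr ((nat_of_bool _)%:R).
  by apply/idP/idP; rewrite inE.
- by move=> x; rewrite lee_fin mulr_ge0 ?ler0n.
transitivity (\int[P]_w (\1_B w * W (Y i w, Y j w))%:E)%E.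
  apply: eq_integral => w _; rewrite integral_unif_law.
  set c := W (Y i w, Y j w).
  have mc : measurable [set x | x <= c].
    rewrite (_ : [set x | x <= c] = `]-oo, c]%classic); first exact: measurable_itv.
    by apply/seteqP; split => x /=; rewrite in_itv.
  transitivity (\int[u]_x ((\1_B w)%:E * (\1_[set x | x <= c] x)%:E))%E.
    apply: eq_integral => x _; rewrite EFinM !indicE.
    by congr (_ * ((nat_of_bool _)%:R)%:E)%E; apply/idP/idP; rewrite inE.
  rewrite ge0_integralZl_EFin ?ler0n//; last first.
    by apply/measurable_EFinP; exact: measurable_indic.
  rewrite EFinM; congr (_ * _)%E.
  rewrite integral_indic// setIT -[LHS]/(@unif01 R _) unif01_le//.
  by rewrite kernel01_ge0 kernel01_le1.
rewrite (@freezing _ _ _ _ _ _ i Yind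
  (fun x => (\1_B x.2 * W (x.1, Y j x.2))%:E))/=; last 2 first.
- apply/measurable_EFinP; apply: measurable_funM.
    exact: (measurableT_comp fmBi measurable_snd).
  apply: measurable_kernel01_comp => //.
  exact: (measurableT_comp mYji measurable_snd).
- by move=> x; rewrite lee_fin mulr_ge0 ?kernel01_ge0.
transitivity (\int[P]_w (\1_B w * degree g (Y j w))%:E)%E.
  apply: eq_integral => w _; rewrite integral_unif_law.
  rewrite -integral_kernel01_scale//.
  by apply: eq_integral => x _; rewrite kernel01_sym.
transitivity (\int[P]_w (p%:E * (\1_B w)%:E))%E; last first.
  rewrite ge0_integralZl_EFin ?edge_density_ge0//.
    by rewrite integral_indic// setIT muleC.
  by apply/measurable_EFinP; exact: measurable_indic.
have mB1 : measurable_fun setT (\1_B : T -> R) by exact: measurable_indic.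
apply: ge0_ae_eq_integral => //.
- apply/measurable_EFinP; apply: measurable_funM => //.
  exact: (measurableT_comp (measurable_degree g) (measurable_funP (Y j))).
- by apply/measurable_EFinP; exact: measurable_funM.
- by move=> w _; rewrite lee_fin mulr_ge0 ?degree_ge0.
- by move=> w _; rewrite lee_fin mulr_ge0 ?edge_density_ge0.
have [N [mN N0 degN]] := g_regular.
exists (Y j @^-1` N); split.
- exact: measurable_preimageY.
- by have [_ law] := Y_iid.1 j; exact: etrans (law N mN) N0.
- move=> w h; apply: degN => dE; apply: h => _.
  by rewrite dE mulrC.
Qed.

End LeafIntegration.

Section ForestProbability.
Variables (R : realType) (g : graph_function R).
Local Notation p := (edge_density g).
Hypothesis g_regular : {ae @unif01 R, forall x, degree g x = p}.
Context d (T : measurableType d) (P : probability T R).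
Variables (n : nat) (X : 'I_n -> {RV P >-> R}) (U : 'I_n -> 'I_n -> {RV P >-> R}).
Local Notation Y := (sampling_family X U).
Local Notation A w := (W_random_graph g X U w).
Hypothesis XU_iid : iid_uniform01 Y.

(** The edge variable belongs to the increasing pair, whichever of (i, j) and
    (j, i) that is; the symmetry of the kernel hides the difference. *)
Lemma W_random_graph_below (i j : 'I_n) : i != j ->
  exists2 e : {e : 'I_n * 'I_n | (e.1 < e.2)%N},
    val e = (i, j) \/ val e = (j, i) &
    forall w, A w i j = (Y (inr e) w <= kernel01 g (X i w, X j w)).
Proof.
move=> ij; have X01 k w : X k w \in `[0, 1] by case: (XU_iid.1 (inl k)).
have XX k l w : unit_square R (X k w, X l w) by split; exact: X01.
have [ltij|ltji|/val_inj eqij] := ltngtP i j; last by rewrite eqij eqxx in ij.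
- exists (exist _ (i, j) ltij) => [|w]; first by left.
  by rewrite /W_random_graph ltij kernel01E.
- exists (exist _ (j, i) ltji) => [|w]; first by right.
  by rewrite /W_random_graph ltji ltnNge (ltnW ltji) /= kernel01_sym kernel01E.
Qed.

Lemma measurable_edge_others a (k l : 'I_n) : k != l ->
  inl k != a -> inl l != a ->
  (forall e, inr e = a -> val e != (k, l) /\ val e != (l, k)) ->
  measurable ([set w | A w k l] : set (othersType Y a)).
Proof.
move=> kl ka la ea; have [e eE AE] := W_random_graph_below kl.
have eb : inr e != a.
  by apply/eqP => /ea[]; case: eE => ->; rewrite eqxx.
rewrite (_ : [set w | A w k l] =
    [set w | Y (inr e) w <= kernel01 g (Y (inl k) w, Y (inl l) w)]).
  by apply: measurable_below; exact: measurable_others.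
by apply/seteqP; split => w /=; rewrite AE.
Qed.

(** The hypothesis says that the pairs {i, f i}, i in S, form a forest: every
    nonempty S' contains a vertex without preimage in S', that is a leaf of the
    forest spanned by S'.  For a singleton it says that f has no fixed point in S.
    Leaves are removed one by one with [leaf_step]. *)
Lemma forest_probability (f : 'I_n -> 'I_n) (S : {set 'I_n}) :
  (forall S' : {set 'I_n}, S' \subset S -> S' != finset.set0 ->
     exists2 i, i \in S' & forall j, j \in S' -> f j != i) ->
  P [set w | forall i, i \in S -> A w i (f i)] = (p ^+ #|S|)%:E.
Proof.
move: {2}#|S| (erefl #|S|) => m; elim: m S => [|m IHm] S cardS leaf.
  have S0 : S = finset.set0 by apply: cards0_eq.
  rewrite cardS expr0 -(probability_setT P); congr (P _).
  by apply/seteqP; split=> // w _ i; rewrite S0 inE.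
have fne k : k \in S -> f k != k.
  move=> kS; have k0 : [set k]%SET != finset.set0 by apply/set0Pn; exists k; rewrite inE.
  have kS' : [set k]%SET \subset S by rewrite finset.sub1set.
  case: (leaf _ kS' k0) => i.
  by rewrite inE => /eqP -> /(_ k); apply; rewrite inE.
have S0 : S != finset.set0 by rewrite -card_gt0 cardS.
have [i iS ileaf] := leaf S (subxx _) S0.
pose S' := (S :\ i)%SET.
have cardS' : #|S'| = m by move: (cardsD1 i S); rewrite iS cardS => -[].
pose B := [set w | forall k, k \in S' -> A w k (f k)].
have iff := fne _ iS; rewrite eq_sym in iff.
have [e eE AE] := W_random_graph_below iff.
have mB a : a = inl i \/ a = inr e -> measurable (B : set (othersType Y a)).
  move=> aE.
  have -> : B = \bigcap_(k in [set` S']) [set w | A w k (f k)].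
    by apply/seteqP; split.
  apply: fin_bigcap_measurable => // k /=; rewrite in_setD1 => /andP[ki kS].
  have fki := ileaf _ kS.
  apply: measurable_edge_others; first by rewrite eq_sym fne.
  - by case: aE => -> //; rewrite (inj_eq inl_inj).
  - by case: aE => -> //; rewrite (inj_eq inl_inj).
  - move=> e' e'a; have -> : e' = e by case: aE e'a => -> // -[].
    case: eE => ->; rewrite !xpair_eqE ![i == _]eq_sym (negbTE ki) (negbTE fki);
    by rewrite ?andbF.
have -> : [set w | forall k, k \in S -> A w k (f k)] =
    B `&` [set w | Y (inr e) w <= kernel01 g (Y (inl i) w, Y (inl (f i)) w)].
  apply/seteqP; split=> w /=.
    move=> AS; split; last by have := AS _ iS; rewrite AE.
    by move=> k; rewrite in_setD1 => /andP[_]; exact: AS.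
  move=> [AB Ai] k kS; have [->|ki] := eqVneq k i; first by rewrite AE.
  by apply: AB; rewrite in_setD1 ki.
rewrite leaf_step//; [|exact: mB (or_introl erefl)|exact: mB (or_intror erefl)].
rewrite IHm// => [|S'' sub]; first by rewrite cardS cardS' exprSr EFinM.
by apply: leaf; apply: fintype.subset_trans sub _; exact: finset.subsetDl.
Qed.

End ForestProbability.

(** * The expected determinant *)

Section Expectation.
Context d (T : measurableType d) (R : realType) (P : probability T R).
Variables (F : finType) (B : F -> set T).
Hypothesis mB : forall f, measurable (B f).

Lemma expectation_indic_sum (k : F -> R) :
  P.-integrable setT (fun w => (\sum_f k f * \1_(B f) w)%:E) /\
  'E_P[(fun w => \sum_f k f * \1_(B f) w)%R]%E = (\sum_f k f * fine (P (B f)))%:E.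
Proof.
have E : (fun w => (\sum_f k f * \1_(B f) w)%:E) =
         (fun w => \sum_f (k f)%:E * (\1_(B f) w)%:E)%E.
  by apply/funext => w; rewrite -sumEFin.
have intB f : P.-integrable setT (fun w => (k f)%:E * (\1_(B f) w)%:E)%E.
  by apply: integrableZl => //; exact: integrable_indic.
split; first by rewrite E; exact: integrable_sum.
rewrite unlock E integral_sum// -sumEFin; apply: eq_bigr => f _.
rewrite integralZl//; last exact: integrable_indic.
by rewrite integral_indic// setIT EFinM fineK// fin_num_measure.
Qed.

Lemma has_expectation_indic_sum (K : F -> R[i]) :
  has_expectation P (fun w => \sum_f K f * (\1_(B f) w)%:C)
    (\sum_f K f * (fine (P (B f)))%:C).
Proof.
have ReE (r : F -> R) :
    complex.Re (\sum_f K f * (r f)%:C) = \sum_f complex.Re (K f) * r f.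
  elim/big_rec2: _ => // f x y _; case: (K f) => a b; case: y => c e /= ->.
  by rewrite mulr0 subr0.
have ImE (r : F -> R) :
    complex.Im (\sum_f K f * (r f)%:C) = \sum_f complex.Im (K f) * r f.
  elim/big_rec2: _ => // f x y _; case: (K f) => a b; case: y => c e /= ->.
  by rewrite mulr0 add0r.
have [iRe ERe] := expectation_indic_sum (fun f => complex.Re (K f)).
have [iIm EIm] := expectation_indic_sum (fun f => complex.Im (K f)).
have fRe : (fun w => complex.Re (\sum_f K f * (\1_(B f) w)%:C)) =
    (fun w => \sum_f complex.Re (K f) * \1_(B f) w).
  by apply/funext => w; rewrite ReE.
have fIm : (fun w => complex.Im (\sum_f K f * (\1_(B f) w)%:C)) =
    (fun w => \sum_f complex.Im (K f) * \1_(B f) w).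
  by apply/funext => w; rewrite ImE.
split.
- by move: iRe; congr (P.-integrable _ _); apply/funext => w; rewrite -(congr1 (@^~ w) fRe).
- by move: iIm; congr (P.-integrable _ _); apply/funext => w; rewrite -(congr1 (@^~ w) fIm).
- by rewrite fRe ERe ReE.
- by rewrite fIm EIm ImE.
Qed.

End Expectation.

Lemma DL_grounded_laplacian (R : realType) n (p : R) z (eps : 'I_n -> R)
    (G : rel 'I_n) : irreflexive G ->
  DL p z eps G = \det (grounded_laplacian
    (fun i => 1 + p%:C * z + (eps i)%:C * z) (- (z / n%:R)) (fun i j => (G i j)%:R)).
Proof.
move=> Girr; congr (\det _); apply/matrixP => i j.
rewrite grounded_laplacianE !mxE.
have -> : \sum_(k | k != i) ((G i k)%:R : R[i]) = #|[pred k | G i k]|%:R.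
  rewrite -sum1_card natr_sum [RHS]big_mkcond/= [LHS]big_mkcond/=.
  apply: eq_bigr => k _; rewrite inE; case: eqVneq => [->|_]; first by rewrite Girr.
  by case: (G i k).
case: (eqVneq i j) => [<-|ij] /=; last by rewrite ?mulr0n ?mulr1n; ring.
by rewrite Girr ?mulr0n ?mulr1n; ring.
Qed.

(** Setting all the weights to p cancels the term pz of y_i: the diagonal part is
    1 + eps_i z and the constant part is pz / n. *)
Lemma DL_mean_grounded_laplacian (R : realType) n (p : R) z (eps : 'I_n -> R) :
  (0 < n)%N ->
  DL_mean p z eps = \det (grounded_laplacian
    (fun i => 1 + p%:C * z + (eps i)%:C * z) (- (z / n%:R)) (fun i j => p%:C)).
Proof.
move=> n0; have nC : n%:R != 0 :> R[i] by rewrite pnatr_eq0 -lt0n.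
pose b i : R[i] := 1 + (eps i)%:C * z.
have E : DL_mean p z eps = n%:R^-1 * \sum_(i < n)
    (1 + p%:C * z + (eps i)%:C * z) * \prod_(j < n | j != i) b j.
  rewrite /DL_mean; case: ifP => // /forallP b0.
  rewrite mulrCA; congr (_ * _); rewrite mulr_sumr; apply: eq_bigr => i _.
  by rewrite (bigD1 i)//= mulrC -mulrA; congr (_ * _); rewrite mulKf.
rewrite E det_grounded_laplacian_const/=.
have bE i : 1 + p%:C * z + (eps i)%:C * z + n%:R * (- (z / n%:R) * p%:C) = b i.
  by rewrite /b; field.
under [X in _ = X - _]eq_bigr do rewrite bE.
under [X in _ = _ - _ * X]eq_bigr do under eq_bigr do rewrite bE.
have -> : \sum_(i < n) (1 + p%:C * z + (eps i)%:C * z) * \prod_(j < n | j != i) b j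
   = \sum_(i < n) (\prod_j b j + p%:C * z * \prod_(j < n | j != i) b j).
  apply: eq_bigr => i _; rewrite [in RHS](bigD1 i)//= -mulrDl; congr (_ * _).
  by rewrite /b; ring.
rewrite big_split/= sumr_const card_ord -mulr_sumr -mulr_natl; field.
by [].
Qed.

Theorem proposition24 (R : realType) (g : graph_function R)
    (g_singular : singular g) (p_gt0 : 0 < edge_density g)
    (n : nat) (n_gt0 : (0 < n)%N) (z : R[i]) (eps : 'I_n -> R)
    (d : measure_display) (T : measurableType d) (P : probability T R)
    (X : 'I_n -> {RV P >-> R}) (U : 'I_n -> 'I_n -> {RV P >-> R})
    (XU_iid : iid_uniform01 (sampling_family X U)) :
  has_expectation P
    (fun w => DL (edge_density g) z eps (W_random_graph g X U w))
    (DL_mean (edge_density g) z eps).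
Proof.
set p := edge_density g; pose A w := W_random_graph g X U w.
pose K (f : {ffun 'I_n -> 'I_n}) := forest_coef
  (fun i => 1 + p%:C * z + (eps i)%:C * z) (- (z / n%:R)) f.
pose S (f : {ffun 'I_n -> 'I_n}) := [set i | f i != i]%SET.
pose B (f : {ffun 'I_n -> 'I_n}) := [set w | forall i, i \in S f -> A w i (f i)].
have Airr w : irreflexive (A w) by move=> i; rewrite /A/W_random_graph !ltnn.
have mB f : measurable (B f).
  have -> : B f = \bigcap_(k in [set` S f]) [set w | A w k (f k)].
    by apply/seteqP; split.
  apply: fin_bigcap_measurable => // k /=; rewrite inE eq_sym => kf.
  have [e _ AE] := W_random_graph_below g XU_iid kf.
  rewrite (_ : [set w | A w k (f k)] =
    [set w | sampling_family X U (inr e) w <= kernel01 g (X k w, X (f k) w)]).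
    by apply: measurable_below; exact: measurable_funP.
  by apply/seteqP; split => w /=; rewrite /A AE.
have -> : DL_mean p z eps = \sum_f K f * (fine (P (B f)))%:C.
  rewrite DL_mean_grounded_laplacian// det_grounded_laplacian.
  apply: eq_bigr => f _.
  (* either f has a cycle and K f = 0, or its moving vertices form a forest *)
  have [/existsP[S' /and3P[S'0 S'S fS']]|acyclic] := boolP [exists S' : {set 'I_n},
      [&& S' != finset.set0, S' \subset S f & S' \subset [set f x | x in S']%SET]].
    rewrite /K (@forest_coef_cyclic _ _ _ _ _ S') ?mul0r// => i /(fintype.subsetP S'S).
    by rewrite inE.
  rewrite -/(K f) forest_probability//; last 2 first.
  - exact: singular_regular.
  - move=> S' S'S S'0; apply: contrapT => noleaf.
    move/negP: acyclic; apply; apply/existsP; exists S'; rewrite S'0 S'S/=.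
    apply/fintype.subsetP => i iS'; apply: contrapT => ifS'; apply: noleaf.
    exists i => // j jS'; apply: contra_notN ifS' => /eqP <-.
    exact: imset_f.
  rewrite /= rmorphXn prodr_const; congr (_ * _ ^+ _).
  by apply: eq_card => i; rewrite inE.
have -> : (fun w => DL p z eps (A w)) =
    (fun w => \sum_f K f * (\1_(B f) w)%:C).
  apply/funext => w; rewrite DL_grounded_laplacian// det_grounded_laplacian.
  apply: eq_bigr => f _; congr (_ * _).
  rewrite indicE; have [inB|outB] := boolP (w \in B f).
    rewrite big1// => i fi; rewrite inE in inB.
    by rewrite (inB i)// inE.
  have [i iS Ai] : exists2 i, i \in S f & ~~ A w i (f i).
    apply: contrapT => noi; move: outB; rewrite notin_setE; apply => i iS.
    by apply: contrapT => /negP Ai; apply: noi; exists i.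
  rewrite inE in iS; rewrite (bigD1 i)//= (negbTE Ai) mul0r.
  by rewrite rmorph0.
exact: has_expectation_indic_sum.
Qed.
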